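(* Let $(G,H)$ be a matched pair of Lie groups with (reflexive) Lie algebras $\mathfrak g,\mathfrak h$. The Lie-Poisson bracket of two functions $\mathcal H=\mathcal H(\mu,\nu)$ and $\mathcal F=\mathcal F(\mu,\nu)$ on $(\mathfrak g\bowtie\mathfrak h)^\ast=\mathfrak g^\ast\oplus\mathfrak h^\ast$ is given by $$\begin{aligned}\{\mathcal H,\mathcal F\}(\mu,\nu)={}&\Big\langle\mu,\Big[\tfrac{\delta\mathcal H}{\delta\mu},\tfrac{\delta\mathcal F}{\delta\mu}\Big]\Big\rangle+\Big\langle\nu,\Big[\tfrac{\delta\mathcal H}{\delta\nu},\tfrac{\delta\mathcal F}{\delta\nu}\Big]\Big\rangle\\&+\Big\langle\mu,\tfrac{\delta\mathcal H}{\delta\nu}\triangleright\tfrac{\delta\mathcal F}{\delta\mu}\Big\rangle-\Big\langle\mu,\tfrac{\delta\mathcal F}{\delta\nu}\triangleright\tfrac{\delta\mathcal H}{\delta\mu}\Big\rangle+\Big\langle\nu,\tfrac{\delta\mathcal H}{\delta\nu}\triangleleft\tfrac{\delta\mathcal F}{\delta\mu}\Big\rangle-\Big\langle\nu,\tfrac{\delta\mathcal F}{\delta\nu}\triangleleft\tfrac{\delta\mathcal H}{\delta\mu}\Big\rangle.\end{aligned}$$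
   Context: A matched pair of Lie groups is a pair $(G,H)$ of Lie groups with a smooth left action $(h,g)\mapsto h\triangleright g$ of $H$ on the manifold $G$ and a smooth right action $(h,g)\mapsto h\triangleleft g$ of $G$ on the manifold $H$, such that $h\triangleright(g_1g_2)=(h\triangleright g_1)\big((h\triangleleft g_1)\triangleright g_2\big)$, $(h_1h_2)\triangleleft g=\big(h_1\triangleleft(h_2\triangleright g)\big)(h_2\triangleleft g)$, $h\triangleright e_G=e_G$, $e_H\triangleleft g=e_H$. The matched pair group $G\bowtie H$ is $G\times H$ with product $(g_1,h_1)(g_2,h_2)=\big(g_1(h_1\triangleright g_2),(h_1\triangleleft g_2)h_2\big)$. With $h\triangleright\xi\in\mathfrak g$ the derivative at $e_G$ of $g\mapsto h\triangleright g$ in direction $\xi$, and $\eta\triangleleft g\in\mathfrak h$ the derivative at $e_H$ of $h\mapsto h\triangleleft g$ in direction $\eta$, the Lie algebra actions are $\eta\triangleright\xi=\frac{d}{dt}\big|_{0}h_t\triangleright\xi\in\mathfrak g$ (for a curve $h_t$ with $h_0=e_H$, $\dot h_0=\eta$) and $\eta\triangleleft\xi=\frac{d}{dt}\big|_{0}\eta\triangleleft g_t\in\mathfrak h$ (for a curve $g_t$ with $g_0=e_G$, $\dot g_0=\xi$). The Lie algebra of $G\bowtie H$ is $\mathfrak g\bowtie\mathfrak h=\mathfrak g\oplus\mathfrak h$ with $[(\xi_1,\eta_1),(\xi_2,\eta_2)]=\big([\xi_1,\xi_2]+\eta_1\triangleright\xi_2-\eta_2\triangleright\xi_1,\,[\eta_1,\eta_2]+\eta_1\triangleleft\xi_2-\eta_2\triangleleft\xi_1\big)$.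 For a Lie algebra $\mathfrak k$ (reflexive, $\mathfrak k^{\ast\ast}=\mathfrak k$, so that $\frac{\delta\mathcal H}{\delta m}\in\mathfrak k$) the Lie-Poisson bracket on $\mathfrak k^\ast$ is $\{\mathcal H,\mathcal F\}(m)=\big\langle m,\big[\frac{\delta\mathcal H}{\delta m},\frac{\delta\mathcal F}{\delta m}\big]\big\rangle$; it is the Poisson reduction of the canonical Poisson bracket on the right trivialization $\mathfrak k^\ast\rtimes K$ of $T^\ast K$ by the right action $(m,k_1)k_2=(m,k_1k_2)$ of the Lie group $K$. Here it is applied to $\mathfrak k=\mathfrak g\bowtie\mathfrak h$, $K=G\bowtie H$; the partial derivatives satisfy $\frac{\delta\mathcal H}{\delta\mu}\in\mathfrak g$, $\frac{\delta\mathcal H}{\delta\nu}\in\mathfrak h$. *)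

(* Defs.v *)
From HB Require Import structures.
From mathcomp Require Import all_boot all_order all_algebra.
From mathcomp Require Import all_classical all_reals.
From mathcomp Require Import topology normedtype landau derive.

Set Implicit Arguments.
Unset Strict Implicit.
Unset Printing Implicit Defensive.

Import Order.TTheory GRing.Theory Num.Theory.
Import numFieldNormedType.Exports.

Local Open Scope classical_set_scope.
Local Open Scope ring_scope.

Section TopologicalDual.
Context {R : realType} {E : normedModType R}.

Definition tdual_pred : {pred E -> R^o} :=
  mem [set f : E -> R^o | linear f /\ continuous f].

Lemma tdual_predP (f : E -> R^o) :
  (f \in tdual_pred) <-> (linear f /\ continuous f).
Proof. by rewrite inE. Qed.

Lemma tdual_submod_closed : submod_closed tdual_pred.
Proof.
split.
  apply/tdual_predP; split; last by move=> x; exact: cst_continuous.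
  by move=> a x y; rewrite /GRing.zero/= scaler0 addr0.
move=> a f g /tdual_predP[lf cf] /tdual_predP[lg cg]; apply/tdual_predP; split.
  move=> b x y; rewrite !addrfctE !scalrfctE lf lg !scalerDr !scalerA.
  by rewrite (mulrC a b) addrACA.
by move=> x; apply: cvgD; [apply: cvgZl_tmp; exact: cf|exact: cg].
Qed.

HB.instance Definition _ :=
  GRing.isSubmodClosed.Build _ _ tdual_pred tdual_submod_closed.

End TopologicalDual.

Record tdual (R : realType) (E : normedModType R) := TDual {
  tdual_fun :> E -> R^o ;
  _ : tdual_fun \in tdual_pred
}.

Section TopologicalDualNorm.
Context {R : realType} {E : normedModType R}.

HB.instance Definition _ := [isSub for @tdual_fun R E].
HB.instance Definition _ := [Choice of tdual E by <:].
HB.instance Definition _ := [SubChoice_isSubLmodule of tdual E by <:].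

Lemma tdual_linear (p : tdual E) : linear p.
Proof. by have /tdual_predP[] := valP p. Qed.

HB.instance Definition _ (p : tdual E) :=
  GRing.isLinear.Build R E R^o *:%R (tdual_fun p) (tdual_linear p).

Lemma tdual_continuous (p : tdual E) : continuous p.
Proof. by have /tdual_predP[] := valP p. Qed.

Definition tdual_norm (p : tdual E) : R :=
  sup [set `|p x| | x in [set x : E | `|x| <= 1]].

Lemma tdual_bounded (p : tdual E) :
  exists2 r, 0 <= r & forall x, `|p x| <= r * `|x|.
Proof.
have /linear_bounded_continuous/linear_boundedP := @tdual_continuous p.
by move=> /pinfty_ex_gt0[r /ltW r0 h]; exists r.
Qed.

Lemma tdual_norm_has_sup (p : tdual E) :
  has_sup [set `|p x| | x in [set x : E | `|x| <= 1]].
Proof.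
have [r r0 pr] := tdual_bounded p; split.
  by exists `|p 0|; exists 0 => //=; rewrite normr0.
exists r => _ [x /= x1 <-]; apply: (le_trans (pr x)).
by rewrite ler_piMr.
Qed.

Lemma tdual_norm_ge0 (p : tdual E) : 0 <= tdual_norm p.
Proof.
apply: (le_trans (normr_ge0 (p 0))).
apply: ub_le_sup; first by case: (tdual_norm_has_sup p).
by exists 0 => //=; rewrite normr0.
Qed.

Lemma tdual_le_norm (p : tdual E) x : `|p x| <= tdual_norm p * `|x|.
Proof.
have [->|x0] := eqVneq x 0; first by rewrite linear0 !normr0 mulr0.
have nx0 : 0 < `|x| by rewrite normr_gt0.
rewrite -ler_pdivrMr// mulrC -(gtr0_norm nx0) -normfV.
have -> : `| `|x|^-1 | * `|p x| = `|p (`|x|^-1 *: x)|.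
  by rewrite linearZ/= normrM.
apply: ub_le_sup; first by case: (tdual_norm_has_sup p).
by exists (`|x|^-1 *: x) => //=; rewrite normrZ normfV normr_id mulVf ?gt_eqF.
Qed.

Lemma tdual_norm_le (p : tdual E) r :
  0 <= r -> (forall x, `|p x| <= r * `|x|) -> tdual_norm p <= r.
Proof.
move=> r0 pr; apply: ge_sup; first by case: (tdual_norm_has_sup p).
by move=> _ [x /= x1 <-]; apply: (le_trans (pr x)); rewrite ler_piMr.
Qed.

Lemma tdual_ext (p q : tdual E) : p =1 q -> p = q.
Proof. by move=> pq; apply/val_inj/funext. Qed.

Lemma tdual_addE (p q : tdual E) x : (p + q) x = p x + q x.
Proof. by []. Qed.

Lemma tdual_scaleE a (p : tdual E) x : (a *: p) x = a *: p x.
Proof. by []. Qed.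

Lemma tdual_ler_normD (p q : tdual E) :
  tdual_norm (p + q) <= tdual_norm p + tdual_norm q.
Proof.
apply: tdual_norm_le => [|x]; first by rewrite addr_ge0// tdual_norm_ge0.
by rewrite tdual_addE mulrDl (le_trans (ler_normD _ _))// lerD// tdual_le_norm.
Qed.

Lemma tdual_normrZ a (p : tdual E) : tdual_norm (a *: p) = `|a| * tdual_norm p.
Proof.
have le b (q : tdual E) : tdual_norm (b *: q) <= `|b| * tdual_norm q.
  apply: tdual_norm_le => [|x]; first by rewrite mulr_ge0// tdual_norm_ge0.
  by rewrite tdual_scaleE normrM -mulrA ler_wpM2l// tdual_le_norm.
apply/eqP; rewrite eq_le le/=.
have [->|a0] := eqVneq a 0; first by rewrite normr0 mul0r tdual_norm_ge0.
rewrite -ler_pdivlMl ?normr_gt0// -normfV.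
rewrite -[leLHS](_ : tdual_norm (a^-1 *: (a *: p)) = _) ?le//.
by rewrite scalerA mulVf// scale1r.
Qed.

Lemma tdual_normr0_eq0 (p : tdual E) : tdual_norm p = 0 -> p = 0.
Proof.
move=> p0; apply: tdual_ext => x; apply/normr0_eq0/eqP.
by rewrite eq_le normr_ge0 andbT (le_trans (tdual_le_norm p x))// p0 mul0r.
Qed.

HB.instance Definition _ := @Lmodule_isNormed.Build R (tdual E)
  tdual_norm tdual_ler_normD tdual_normrZ tdual_normr0_eq0.

Definition bidual_fun (x : E) : tdual E -> R^o := fun p => p x.

Lemma bidual_subproof (x : E) : bidual_fun x \in @tdual_pred R (tdual E).
Proof.
apply/tdual_predP.
have lin : linear (bidual_fun x) by [].
split=> //.
pose L := GRing.isLinear.Build R (tdual E) R^o *:%R (bidual_fun x) lin.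
pose f : {linear tdual E -> R^o} := HB.pack (bidual_fun x) L.
apply: (@bounded_linear_continuous _ _ _ f); apply/linear_boundedP.
apply: filterS (nbhs_pinfty_ge (num_real `|x|)) => r xr p.
apply: (le_trans (tdual_le_norm p x)); rewrite mulrC.
by apply: ler_wpM2r => //; exact: tdual_norm_ge0.
Qed.

Definition bidual (x : E) : tdual (tdual E) := TDual (bidual_subproof x).

End TopologicalDualNorm.

(* A reflexive normed space is isometric to a dual, so it is a Banach space:
   completeness need not be assumed separately. *)
Definition reflexive_space (R : realType) (E : normedModType R) :=
  bijective (@bidual R E).

(* The identification of E^* (+) F^* with (E (+) F)^*. *)
Section DualSum.
Context {R : realType} {E F : normedModType R}.
Implicit Types (mu : tdual E) (nu : tdual F).

Definition tdual_sum_fun mu nu : E * F -> R^o := fun z => mu z.1 + nu z.2.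

Lemma tdual_sum_subproof mu nu :
  tdual_sum_fun mu nu \in @tdual_pred R (E * F)%type.
Proof.
apply/tdual_predP; split=> [a z w|z].
  by rewrite /tdual_sum_fun !linearP/= scalerDr addrACA.
apply: cvgD.
  by apply: continuous_comp; [exact: cvg_fst|exact: tdual_continuous].
by apply: continuous_comp; [exact: cvg_snd|exact: tdual_continuous].
Qed.

Definition tdual_sum mu nu : tdual (E * F)%type :=
  TDual (tdual_sum_subproof mu nu).

End DualSum.


(* [C_on n U f]: f is of class C^n on the open set U, by induction on the
   tangent map (x, v) |-> 'd f x v.  For a fixed n this is slightly weaker
   than n-fold continuous Frechet differentiability (the derivative is only
   required to be jointly continuous in (x, v)), but class C^n.+1 in this
   sense implies class C^n in the Frechet sense, so that the two notions of
   smoothness coincide. *)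
Fixpoint C_on (R : realType) (n : nat) :
    forall E F : normedModType R, set E -> (E -> F) -> Prop :=
  match n with
  | 0%N => fun E F U f => forall x, U x -> {for x, continuous f}
  | n'.+1 => fun E F U f =>
      (forall x, U x -> differentiable f x) /\
      @C_on R n' (E * E)%type F (U `*` setT) (fun p => 'd f (p.1) (p.2))
  end.

Definition smooth_on (R : realType) (E F : normedModType R)
    (U : set E) (f : E -> F) :=
  forall n, C_on n U f.

Record chart (R : realType) (M : Type) (E : normedModType R) := Chart {
  chart_dom : set M ;
  chart_img : set E ;
  chart_fun :> M -> E ;
  chart_inv : E -> M
}.

Definition prod_chart (R : realType) (M N : Type) (E F : normedModType R)
    (c : chart M E) (d : chart N F) : chart (M * N)%type (E * F)%type :=
  Chart (chart_dom c `*` chart_dom d) (chart_img c `*` chart_img d)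
        (fun z => (c z.1, d z.2))
        (fun z => (chart_inv c z.1, chart_inv d z.2)).

Definition prod_atlas (R : realType) (M N : Type) (E F : normedModType R)
    (A : set (chart M E)) (B : set (chart N F)) :
    set (chart (M * N)%type (E * F)%type) :=
  [set prod_chart c d | c in A & d in B].

(* [chart_inv c] is only meaningful on [chart_img c], and [c] on
   [chart_dom c]. *)
Definition is_chart (R : realType) (M : topologicalType)
    (E : normedModType R) (c : chart M E) :=
  [/\ open (chart_dom c) /\ open (chart_img c),
      set_fun (chart_dom c) (chart_img c) c,
      set_fun (chart_img c) (chart_dom c) (chart_inv c),
      {in chart_dom c, cancel c (chart_inv c)} /\
      {in chart_img c, cancel (chart_inv c) c} &
      {in chart_dom c, continuous c} /\
      {in chart_img c, continuous (chart_inv c)}].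

Definition smooth_atlas (R : realType) (M : topologicalType)
    (E : normedModType R) (A : set (chart M E)) :=
  [/\ forall c, A c -> is_chart c,
      forall x, exists2 c, A c & chart_dom c x &
      forall c d, A c -> A d ->
        smooth_on (chart_img c `&` chart_inv c @^-1` chart_dom d)
                  (d \o chart_inv c)].

Definition smooth_map (R : realType) (M N : topologicalType)
    (E F : normedModType R) (A : set (chart M E)) (B : set (chart N F))
    (f : M -> N) :=
  continuous f /\
  forall c d, A c -> B d ->
    smooth_on (chart_img c `&` (f \o chart_inv c) @^-1` chart_dom d)
              (d \o f \o chart_inv c).

(* [lie_chart] is a distinguished chart at the identity; it is used to
   identify the tangent space at the identity with the model space. *)
HB.mixin Record isLieGroup (R : realType) (E : normedModType R) G
    of Group G & Topological G := {
  lie_atlas : set (chart G E) ;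
  lie_chart : chart G E ;
  lie_atlasP : smooth_atlas lie_atlas ;
  lie_chart_atlas : lie_atlas lie_chart ;
  lie_chart1 : chart_dom lie_chart 1%g ;
  lie_hausdorff : hausdorff_space G ;
  lie_mul_smooth : smooth_map (prod_atlas lie_atlas lie_atlas) lie_atlas
    (fun z : G * G => (z.1 * z.2)%g) ;
  lie_inv_smooth : smooth_map lie_atlas lie_atlas (fun g : G => g^-1%g)
}.

#[short(type="lieGroupType")]
HB.structure Definition LieGroup (R : realType) (E : normedModType R) :=
  {G of isLieGroup R E G & Group G & Topological G}.

Arguments lie_atlas {R E} G : rename.
Arguments lie_chart {R E} G : rename.

(* Everything is expressed in the coordinates of a chart [c] at the identity,
   in which the tangent space at the identity is the model space [E].
   ['D_v f x] is the derivative at 0 of t |-> f (x + t v); precomposing f with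
   [chart_inv c] makes it, at x = c 1, a derivative along the curve
   t |-> chart_inv c (c 1 + t v), which starts at 1 with velocity v. *)

Section LieBracket.
Context {R : realType} {E : normedModType R} {K : groupType} (c : chart K E).

(* Representative near [c 1] of the left-invariant vector field
   k |-> d/dt k k_t, where k_t has velocity xi at k_0 = 1. *)
Definition left_invariant_field (xi : E) (x : E) : E :=
  'D_xi (fun y => c (chart_inv c x * chart_inv c y)%g) (c 1%g).

Definition field_bracket (X Y : E -> E) (x : E) : E :=
  'D_(X x) Y x - 'D_(Y x) X x.

Definition lie_bracket (xi eta : E) : E :=
  field_bracket (left_invariant_field xi) (left_invariant_field eta) (c 1%g).

End LieBracket.

Record matched_pair (R : realType) (E F : normedModType R)
    (G : lieGroupType E) (H : lieGroupType F) := MatchedPair {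
  lact : H -> G -> G ;
  ract : H -> G -> H ;
  lact_smooth : smooth_map (prod_atlas (lie_atlas H) (lie_atlas G))
    (lie_atlas G) (fun z : H * G => lact z.1 z.2) ;
  ract_smooth : smooth_map (prod_atlas (lie_atlas H) (lie_atlas G))
    (lie_atlas H) (fun z : H * G => ract z.1 z.2) ;
  lact1g : forall g, lact 1%g g = g ;
  lactMg : forall h1 h2 g, lact (h1 * h2)%g g = lact h1 (lact h2 g) ;
  ractg1 : forall h, ract h 1%g = h ;
  ractgM : forall h g1 g2, ract h (g1 * g2)%g = ract (ract h g1) g2 ;
  lactgM : forall h g1 g2,
    lact h (g1 * g2)%g = (lact h g1 * lact (ract h g1) g2)%g ;
  ractMg : forall h1 h2 g,
    ract (h1 * h2)%g g = (ract h1 (lact h2 g) * ract h2 g)%g ;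
  lactg1 : forall h, lact h 1%g = 1%g ;
  ract1g : forall g, ract 1%g g = 1%g
}.

Section MatchedPairGroup.
Context {R : realType} {E F : normedModType R}.
Context {G : lieGroupType E} {H : lieGroupType F}.

Definition matched_group (A : matched_pair G H) : Type := (G * H)%type.

Context (A : matched_pair G H).
Local Notation K := (matched_group A).

HB.instance Definition _ := Choice.copy K (G * H)%type.

Let mul (z w : K) : K :=
  ((z.1 * lact A z.2 w.1)%g, (ract A z.2 w.1 * w.2)%g).
Let one : K := (1%g, 1%g).
Let inv (z : K) : K :=
  (lact A z.2^-1%g z.1^-1%g, ract A z.2^-1%g z.1^-1%g).

Let mulA : associative mul.
Proof.
move=> [g1 h1] [g2 h2] [g3 h3]; rewrite /mul/=; congr pair.
  by rewrite lactgM lactMg mulgA.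
by rewrite ractMg ractgM mulgA.
Qed.

Let mul1 : left_id one mul.
Proof. by move=> [g h]; rewrite /mul/= lact1g ract1g !mul1g. Qed.

Let mulr1 : right_id one mul.
Proof. by move=> [g h]; rewrite /mul/= lactg1 ractg1 !mulg1. Qed.

Let mulV : left_inverse one inv mul.
Proof.
move=> [g h]; rewrite /mul/inv/=; congr pair.
  by rewrite -lactgM mulVg lactg1.
by rewrite -ractgM mulVg ractg1 mulVg.
Qed.

Let mulrV : right_inverse one inv mul.
Proof.
move=> [g h]; rewrite /mul/inv/=; congr pair.
  by rewrite -lactMg mulgV lact1g mulgV.
by rewrite -ractMg mulgV ract1g.
Qed.

HB.instance Definition _ := isGroup.Build K mulA mul1 mulr1 mulV mulrV.

Definition matched_chart : chart K (E * F)%type :=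
  prod_chart (lie_chart G) (lie_chart H).

End MatchedPairGroup.

Section LieAlgebraActions.
Context {R : realType} {E F : normedModType R}.
Context {G : lieGroupType E} {H : lieGroupType F} (A : matched_pair G H).
Local Notation phi := (lie_chart G).
Local Notation psi := (lie_chart H).

(* h |> xi, eta <| g, and then eta |> xi, eta <| xi.  Since h |> 1 = 1 and
   1 <| g = 1, the charts at the identity can be used on both sides. *)
Definition lact_tangent (h : H) (xi : E) : E :=
  'D_xi (fun x => phi (lact A h (chart_inv phi x))) (phi 1%g).

Definition ract_tangent (eta : F) (g : G) : F :=
  'D_eta (fun y => psi (ract A (chart_inv psi y) g)) (psi 1%g).

Definition lact_alg (eta : F) (xi : E) : E :=
  'D_eta (fun y => lact_tangent (chart_inv psi y) xi) (psi 1%g).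

Definition ract_alg (eta : F) (xi : E) : F :=
  'D_xi (fun x => ract_tangent eta (chart_inv phi x)) (phi 1%g).

End LieAlgebraActions.

Section LiePoisson.
Context {R : realType} {E : normedModType R}.
Implicit Types (f : tdual E -> R^o) (m : tdual E).

(* The element of E representing 'd f m, which is a point of the bidual; it
   exists and is unique when E is reflexive and f is differentiable at m. *)
Definition functional_derivative f m : E :=
  xget 0 [set x | forall p : tdual E, 'd f m p = p x].

Definition lie_poisson (K : groupType) (c : chart K E) f1 f2 m : R :=
  m (lie_bracket c (functional_derivative f1 m) (functional_derivative f2 m)).

End LiePoisson.

Section PartialDerivatives.
Context {R : realType} {E F : normedModType R}.
Implicit Types (f : tdual (E * F)%type -> R^o) (mu : tdual E) (nu : tdual F).

Definition partial_fst f mu nu : E :=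
  functional_derivative (fun mu' => f (tdual_sum mu' nu)) mu.

Definition partial_snd f mu nu : F :=
  functional_derivative (fun nu' => f (tdual_sum mu nu')) nu.

End PartialDerivatives.

(* Main.v *)
(* In the charts at the identities, let m, n, l and r be the products of G and
   H and the two actions, with identities at a0 and b0, and write D_i for the
   partial derivative in the i-th variable.  The left-invariant field of the
   matched pair group with value (xi, eta) at the identity is, near (a0, b0),
     (a, b) |-> (D_2 m(a, a0) (D_2 l(b, a0) xi),
                 D_2 r(b, a0) xi + D_2 n(b, b0) eta).
   Differentiating at (a0, b0) in the direction (xi', eta') gives the brackets
   of G and H, the term eta' |> xi, and D_1 D_2 r(b0, a0) applied to eta' and
   xi, which is eta' <| xi by symmetry of second derivatives.  By reflexivity,
   the derivative of a function of (mu, nu) is the pair of its partial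
   functional derivatives, so the formula follows by pairing with (mu, nu). *)
From HB Require Import structures.
Require Import Defs.
From mathcomp Require Import all_boot all_order all_algebra.
From mathcomp Require Import all_classical all_reals.
From mathcomp Require Import topology normedtype landau derive.
Set Implicit Arguments.
Unset Strict Implicit.
Unset Printing Implicit Defensive.
Import Order.TTheory GRing.Theory Num.Theory.
Import numFieldNormedType.Exports.
Local Open Scope classical_set_scope.
Local Open Scope ring_scope.

Lemma continuous_for_pair (T U V : topologicalType) (f : T -> U)
    (g : T -> V) x :
  {for x, continuous f} -> {for x, continuous g} ->
  {for x, continuous (fun y => (f y, g y))}.
Proof. by move=> cf cg; exact: (cvg_pair cf cg). Qed.

(** * Differential calculus *)

Section Calculus.
Context {R : realType}.
Implicit Types V W X : normedModType R.

(** The bound by 1 makes the linear map continuous, hence its own differential. It covers the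
    projections of a product and the inclusions of the summands of a dual. *)
Lemma is_diff_linear_contraction V W (f : V -> W) x :
  linear f -> (forall y, `|f y| <= `|y|) -> is_diff x f f.
Proof.
move=> lin f1.
pose L : {linear V -> W} := HB.pack f (GRing.isLinear.Build _ _ _ _ _ lin).
have cL : continuous L.
  apply: bounded_linear_continuous; apply/linear_boundedP.
  apply: filterS (nbhs_pinfty_ge (num_real 1)) => r r1 y.
  by rewrite (le_trans (f1 y))// ler_peMl.
rewrite -[f]/(L : V -> W).
by apply: DiffDef; [exact: linear_differentiable|rewrite diff_lin].
Qed.

Lemma is_diff_fst V W (z : V * W) : is_diff z fst fst.
Proof.
apply: is_diff_linear_contraction => [//|y].
by rewrite [leRHS]/Num.norm/= le_max lexx.
Qed.

Lemma is_diff_snd V W (z : V * W) : is_diff z snd snd.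
Proof.
apply: is_diff_linear_contraction => [//|y].
by rewrite [leRHS]/Num.norm/= le_max lexx orbT.
Qed.

(** Chain rule for an inner map with an explicit differential and an outer map known only through
    ['d g], the shape in which the tangent maps below occur. *)
Lemma is_derive_comp_diff V W X (f df : V -> W) (g : W -> X) (x v : V) :
  is_diff x f df -> differentiable g (f x) ->
  is_derive x v (g \o f) ('d g (f x) (df v)).
Proof.
move=> dfx dg; have gf : differentiable (g \o f) x.
  exact: differentiable_comp.
apply: DeriveDef; first exact: diff_derivable.
by rewrite deriveE// diff_comp// /= diff_val.
Qed.

Lemma is_derive_diff V W (f df : V -> W) (x v : V) :
  is_diff x f df -> is_derive x v f (df v).
Proof.
move=> dfx; apply: DeriveDef; first exact: diff_derivable.
by rewrite deriveE// diff_val.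
Qed.

Lemma is_derive_pair V W X (f : V -> W) (g : V -> X) (x v : V) df dg :
  is_derive x v f df -> is_derive x v g dg ->
  is_derive x v (fun y => (f y, g y)) (df, dg).
Proof.
move=> [fx <-] [gx <-]; apply: DeriveDef.
  apply/cvg_ex; exists ('D_v f x, 'D_v g x).
  exact: (cvg_pair fx gx).
by apply: cvg_lim => //; exact: (cvg_pair fx gx).
Qed.

(* Two applications of the mean value theorem: first to
   x |-> g x t - g x 0, then to g1 x. *)
Lemma mixed_difference (g g1 g12 : R -> R -> R) (s t : R) :
  0 < s -> 0 < t ->
  (forall x y, 0 <= x <= s -> 0 <= y <= t ->
     is_derive x 1 (g^~ y) (g1 x y) /\ is_derive y 1 (g1 x) (g12 x y)) ->
  exists2 z : R * R, (0 <= z.1 <= s) /\ (0 <= z.2 <= t) &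
    g s t - g s 0 - (g 0 t - g 0 0) = g12 z.1 z.2 * (s * t).
Proof.
move=> s0 t0 dg.
have t0' := ltW t0.
have du x : 0 <= x <= s ->
    is_derive x 1 (fun x => g x t - g x 0) (g1 x t - g1 x 0).
  move=> xs; have [gt _] := dg x t xs (introT andP (conj t0' (lexx t))).
  have [g0 _] := dg x 0 xs (introT andP (conj (lexx 0) t0'));
  exact: is_deriveB.
have [x||x xs ->] := MVT (f := fun x => g x t - g x 0)
  (df := fun x => g1 x t - g1 x 0) s0.
- by rewrite in_itv/= => /andP[x0 xs]; apply: du; rewrite !ltW.
- by apply: derivable_within_continuous => y; rewrite in_itv/= => /du[].
have xs' : 0 <= x <= s.
  by move: xs; rewrite in_itv/= => /andP[x0 xs]; rewrite !ltW.
have [y||y yt ->] := MVT (f := g1 x) (df := g12 x) t0.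
- by rewrite in_itv/= => /andP[y0 yt]; have [] := dg x y xs'; rewrite ?ltW.
- apply: derivable_within_continuous => y; rewrite in_itv/= => yt.
  by have [_ []] := dg x y xs' yt.
exists (x, y); last by rewrite !subr0 mulrAC -mulrA.
by split => //; move: yt; rewrite in_itv/= => /andP[y0 yt]; rewrite !ltW.
Qed.

(** On a small square at 0 the second difference of [g] is the area times a value of [g12], and also
    the area times a value of [g21]. These two values agree, and by continuity each is within
    [e / 2] of its value at 0. *)
Lemma schwarz_real (g g1 g2 g12 g21 : R -> R -> R) :
  nbhs (0 : R * R) [set z : R * R |
     [/\ is_derive z.1 1 (g^~ z.2) (g1 z.1 z.2),
         is_derive z.2 1 (g1 z.1) (g12 z.1 z.2),
         is_derive z.2 1 (g z.1) (g2 z.1 z.2) &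
         is_derive z.1 1 (g2^~ z.2) (g21 z.1 z.2)]] ->
  {for (0 : R * R), continuous (fun z => g12 z.1 z.2)} ->
  {for (0 : R * R), continuous (fun z => g21 z.1 z.2)} ->
  g12 0 0 = g21 0 0.
Proof.
move=> dg c12 c21.
apply/eqP; rewrite -subr_eq0 -normr_le0; apply/ler_addgt0Pr => e e0.
have e20 : 0 < e / 2 by rewrite divr_gt0.
move/cvgrPdist_lt/(_ _ e20) : c12 => c12.
move/cvgrPdist_lt/(_ _ e20) : c21 => c21.
have /nbhs_ballP[r /= r0 H] : nbhs (0 : R * R) [set z : R * R |
    [/\ [/\ is_derive z.1 1 (g^~ z.2) (g1 z.1 z.2),
         is_derive z.2 1 (g1 z.1) (g12 z.1 z.2),
         is_derive z.2 1 (g z.1) (g2 z.1 z.2) &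
         is_derive z.1 1 (g2^~ z.2) (g21 z.1 z.2)],
     `|g12 0 0 - g12 z.1 z.2| < e / 2 & `|g21 0 0 - g21 z.1 z.2| < e / 2]].
  by near do split.
(* Halving the radius puts the closed square of side [r / 2] inside the open ball. *)
have s0 : 0 < r / 2 by rewrite divr_gt0.
have Hb x y : 0 <= x <= r / 2 -> 0 <= y <= r / 2 -> ball (0 : R * R) r (x, y).
  have h z : 0 <= z <= r / 2 -> ball (0 : R) r z.
    move=> /andP[z0 zr]; rewrite /ball/= sub0r normrN ger0_norm//.
    by rewrite (le_lt_trans zr)// ltr_pdivrMr// ltr_pMr// ltr1n.
  by move=> /h xr /h yr; split.
have [x y xr yr|z [z1 z2] E1] := @mixed_difference g g1 g12 _ _ s0 s0.
  by have [[]] := H _ (Hb _ _ xr yr).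
(* The same square with the variables exchanged, so the coordinates of [w] come out in reverse
   order. *)
have [y x yr xr|w [w1 w2] E2] :=
    @mixed_difference (fun y x => g x y) (fun y x => g2 x y)
      (fun y x => g21 x y) _ _ s0 s0.
  by have [[]] := H _ (Hb _ _ xr yr).
have E : g12 z.1 z.2 = g21 w.2 w.1.
  have ss0 : r / 2 * (r / 2) != 0 by rewrite mulf_neq0// gt_eqF.
  apply: (mulIf ss0); rewrite -E1 -E2 !opprB.
  by rewrite addrACA [RHS]addrACA [- _ + _]addrC.
have [_ h1 _] := H _ (Hb _ _ z1 z2).
have [_ _ h2] := H _ (Hb _ _ w2 w1).
rewrite add0r (splitr e) (le_trans _ (ltW (ltrD h1 h2)))//=.
rewrite E (distrC (g21 0 0)); apply: (le_trans _ (ler_normD _ _)).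
by rewrite addrA subrK.
Unshelve. all: by end_near. Qed.

(** Names the map on which the recursion of [C_on] runs, so that regularity of derivatives can be
    read off the successive levels of [C_on]. *)
Definition tangent_map V W (f : V -> W) : V * V -> W :=
  fun p => 'd f (p.1) (p.2).

(** Order two is what the bracket calls for: left-invariant fields are first derivatives of the
    product, and the bracket differentiates them once more. *)
Definition C2_near V W (f : V -> W) (x : V) :=
  exists2 U, nbhs x U & C_on 2 U f.

Lemma C2_near_diff V W (f : V -> W) x :
  C2_near f x -> \forall y \near x, differentiable f y.
Proof. by move=> [U xU [df _]]; apply: filterS xU. Qed.

Lemma C2_near_diff_tangent V W (f : V -> W) x v :
  C2_near f x -> differentiable (tangent_map f) (x, v).
Proof. by move=> [U /nbhs_singleton Ux [_ [df _]]]; exact: df. Qed.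

Lemma is_diff_tdual W (p : tdual W) y : is_diff y (p : W -> R^o) p.
Proof.
have pc := @tdual_continuous _ _ p.
apply: DiffDef; first exact: linear_differentiable.
by rewrite diff_lin.
Qed.

Lemma is_derive_tdual_comp V W (p : tdual W) (g : V -> W) (c dc : R -> V) s :
  is_diff s c dc -> differentiable g (c s) ->
  is_derive s 1 (fun s => p (g (c s))) (p ('d g (c s) (dc 1))).
Proof.
move=> dcs dg.
have dg' : is_diff (c s) g ('d g (c s)) by exact: differentiableP.
have dp := is_diff_tdual p (g (c s)).
exact: (@is_derive_diff _ _ (p \o (g \o c)) (p \o ('d g (c s) \o dc))).
Qed.

(* Testing against a functional p reduces the symmetry of the second
   derivative to real-valued functions, where the mean value theorem holds. *)
Lemma C2_near_symmetric V W (f : V -> W) (x u v : V) (p : tdual W) :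
  C2_near f x ->
  p ('d (tangent_map f) (x, u) (v, 0)) = p ('d (tangent_map f) (x, v) (u, 0)).
Proof.
move=> [U xU [df [ddf cf]]].
(* Restricting [f] to the plane through [x] spanned by [u] and [v] gives a function of two real
   variables. *)
pose z (s t : R) := x + s *: u + t *: v.
have zc : {for (0 : R * R), continuous (fun w : R * R => z w.1 w.2)}.
  apply: cvgD; first apply: cvgD; first exact: cvg_cst.
    by apply: cvgZr_tmp; exact: cvg_fst.
  by apply: cvgZr_tmp; exact: cvg_snd.
have z0 : U (z 0 0) by rewrite /z !scale0r !addr0; exact: nbhs_singleton.
have zU : \forall w \near (0 : R * R), U (z w.1 w.2).
  have zU : nbhs (z 0 0) U by rewrite /z !scale0r !addr0.
  exact: (zc _ zU).
have dz1 s t : is_diff s (z^~ t) (fun h : R => h *: u).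
  have -> : z^~ t = (cst (x + t *: v)) + *:%R^~ u.
    by apply/funext => h; rewrite /z /= addrAC.
  have := is_diffD (is_diff_cst (x + t *: v) s) (is_diff_scalel s u).
  by rewrite add0r.
have dz2 s t : is_diff t (z s) (fun h : R => h *: v).
  have -> : z s = (cst (x + s *: u)) + *:%R^~ v.
    by apply/funext => h; rewrite /z /=.
  have := is_diffD (is_diff_cst (x + s *: u) t) (is_diff_scalel t v).
  by rewrite add0r.
(* The second derivative of [f] along the plane, first in the direction [a] and then in the
   direction [b], tested against [p]. *)
pose D (a b : V) s t : R := p ('d (tangent_map f) (z s t, a) (b, 0)).
have Dc a b : {for (0 : R * R), continuous (fun w : R * R => D a b w.1 w.2)}.
  apply: continuous_comp; last exact: tdual_continuous.
  apply: (@continuous_comp _ _ _ (fun w => ((z w.1 w.2, a), (b, 0)))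
    (fun q => 'd (tangent_map f) (q.1) (q.2))).
    apply: continuous_for_pair; last exact: cst_continuous.
    by apply: continuous_for_pair; [exact: zc|exact: cst_continuous].
  by apply: cf; do 2!split.
have -> : p ('d (tangent_map f) (x, u) (v, 0)) = D u v 0 0.
  by rewrite /D /z !scale0r !addr0.
have -> : p ('d (tangent_map f) (x, v) (u, 0)) = D v u 0 0.
  by rewrite /D /z !scale0r !addr0.
apply: (@schwarz_real (fun s t => p (f (z s t)))
  (fun s t => p ('d f (z s t) u)) (fun s t => p ('d f (z s t) v))) => //.
near=> w.
have Uw : U (z w.1 w.2) by near: w.
have dU1 : differentiable f (z w.1 w.2) by exact: df.
have dU2 a : differentiable (tangent_map f) (z w.1 w.2, a) by exact: ddf.
have dz1a (a : V) :
    is_diff (w.1) (fun s => (z s w.2, a)) (fun h : R => (h *: u, 0)).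
  exact: (is_diff_pair (dz1 w.1 w.2) (is_diff_cst a w.1)).
have dz2a (a : V) :
    is_diff (w.2) (fun t => (z w.1 t, a)) (fun h : R => (h *: v, 0)).
  exact: (is_diff_pair (dz2 w.1 w.2) (is_diff_cst a w.2)).
split=> /=.
(* The direction is written [1 *: u] to be recognized as the velocity of the coordinate line;
   likewise in the other three cases. *)
- by rewrite -[X in 'd f _ X]scale1r; exact: is_derive_tdual_comp.
- by rewrite /D -[X in (X, 0)]scale1r; exact: (is_derive_tdual_comp p (dz2a u)).
- by rewrite -[X in 'd f _ X]scale1r; exact: is_derive_tdual_comp.
- by rewrite /D -[X in (X, 0)]scale1r; exact: (is_derive_tdual_comp p (dz1a v)).
Unshelve. all: by end_near. Qed.

End Calculus.

(** * Functional derivatives on a direct sum *)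

Section FunctionalDerivative.
Context {R : realType}.
Implicit Types E F : normedModType R.

(** The differential is a continuous linear functional on the dual, hence a point of the bidual.
    Surjectivity of [bidual] represents it by a vector, so [xget] does not fall back on its default
    0. *)
Lemma functional_derivativeP E (f : tdual E -> R^o) (m p : tdual E) :
  reflexive_space E -> differentiable f m ->
  'd f m p = p (functional_derivative f m).
Proof.
move=> [g _ gK] df.
have dual_df : ('d f m : tdual E -> R^o) \in tdual_pred.
  by apply/tdual_predP; split; [exact: linearP|exact: diff_continuous].
apply: (@xgetPex _ 0 [set x | forall p : tdual E, 'd f m p = p x]).
by exists (g (TDual dual_df)) => q; rewrite -[q _]/(bidual _ q) gK.
Qed.

Lemma tdual_separates E (x y : E) :
  reflexive_space E -> (forall p : tdual E, p x = p y) -> x = y.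
Proof. by move=> /bij_inj inj pxy; apply: inj; exact: tdual_ext. Qed.

(** Phrased with separation of points so that it applies to a product, where separation is checked
    on each factor. *)
Lemma functional_derivative_eq E (f : tdual E -> R^o) (m : tdual E) (x : E) :
  (forall y, (forall p : tdual E, p x = p y) -> x = y) ->
  (forall p, 'd f m p = p x) -> functional_derivative f m = x.
Proof.
move=> sep fx; apply/esym/sep => p.
rewrite -fx; apply: (@xgetPex _ 0 [set x | forall p : tdual E, 'd f m p = p x]).
by exists x.
Qed.

Context {E F : normedModType R}.

(** The two functionals are the restrictions of [p] to the summands; this is the surjectivity of the
    identification of the sum of the duals with the dual of the sum. *)
Lemma tdual_sum_decomp (p : tdual (E * F)%type) : exists q r, p = tdual_sum q r.
Proof.
have qP : (fun x : E => p (x, 0)) \in @tdual_pred R E.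
  apply/tdual_predP; split=> [a x y|x].
    by rewrite -linearP; congr (p _); congr pair; rewrite /= ?scaler0 ?addr0.
  apply: (@continuous_comp _ _ _ (fun x : E => (x, 0 : F)));
    last exact: tdual_continuous.
  by apply: continuous_for_pair; last exact: cst_continuous.
have rP : (fun x : F => p (0, x)) \in @tdual_pred R F.
  apply/tdual_predP; split=> [a x y|x].
    by rewrite -linearP; congr (p _); congr pair; rewrite /= ?scaler0 ?addr0.
  apply: (@continuous_comp _ _ _ (fun x : F => (0 : E, x)));
    last exact: tdual_continuous.
  by apply: continuous_for_pair; first exact: cst_continuous.
exists (TDual qP), (TDual rP); apply: tdual_ext => -[x y] /=.
rewrite /tdual_sum_fun/= -linearD; congr (p _).
by congr pair; rewrite ?addr0 ?add0r.
Qed.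

Lemma tdual_sum_l (mu : tdual E) z : tdual_sum mu (0 : tdual F) z = mu z.1.
Proof. exact: addr0. Qed.

Lemma tdual_sum_r (nu : tdual F) z : tdual_sum (0 : tdual E) nu z = nu z.2.
Proof. exact: add0r. Qed.

Lemma tdual_sum_lr mu nu :
  tdual_sum mu nu = tdual_sum mu 0 + tdual_sum 0 nu :> tdual (E * F)%type.
Proof.
by apply: tdual_ext => z; rewrite tdual_addE tdual_sum_l tdual_sum_r.
Qed.

(** Puts the six terms in the order of the final formula. *)
Lemma tdual_sum_addB (mu : tdual E) (nu : tdual F) x x1 x2 y y1 y2 :
  tdual_sum mu nu (x + x1 - x2, y + y1 - y2) =
  mu x + nu y + mu x1 - mu x2 + nu y1 - nu y2.
Proof.
rewrite -[LHS]/(mu (x + x1 - x2) + nu (y + y1 - y2)).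
rewrite (linearB mu) (linearB nu) (linearD mu) (linearD nu).
rewrite !addrA; congr (_ - _); congr (_ + _).
by rewrite addrAC; congr (_ - _); rewrite addrAC.
Qed.

(** The map is a translate of a linear one, which is a contraction because the product carries the
    maximum norm. *)
Lemma is_diff_tdual_sum_l (mu : tdual E) (nu : tdual F) :
  is_diff mu (tdual_sum^~ nu) (tdual_sum^~ 0).
Proof.
have dL : is_diff mu (tdual_sum^~ (0 : tdual F)) (tdual_sum^~ 0).
  apply: is_diff_linear_contraction => [a p q|p].
    by apply: tdual_ext => z; rewrite tdual_addE tdual_scaleE !tdual_sum_l.
  apply: tdual_norm_le => [|z]; first exact: tdual_norm_ge0.
  rewrite tdual_sum_l (le_trans (tdual_le_norm p _))//.
  by rewrite ler_wpM2l ?tdual_norm_ge0// [leRHS]/Num.norm/= le_max lexx.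
have -> : tdual_sum^~ nu =
    (fun p : tdual E => tdual_sum p 0) + cst (tdual_sum 0 nu).
  by apply/funext => p; rewrite tdual_sum_lr.
by have := is_diffD dL (is_diff_cst (tdual_sum 0 nu) mu); rewrite addr0.
Qed.

Lemma is_diff_tdual_sum_r (mu : tdual E) (nu : tdual F) :
  is_diff nu (tdual_sum mu) (tdual_sum 0).
Proof.
have dL : is_diff nu (tdual_sum (0 : tdual E)) (tdual_sum 0).
  apply: is_diff_linear_contraction => [a p q|p].
    by apply: tdual_ext => z; rewrite tdual_addE tdual_scaleE !tdual_sum_r.
  apply: tdual_norm_le => [|z]; first exact: tdual_norm_ge0.
  rewrite tdual_sum_r (le_trans (tdual_le_norm p _))//.
  by rewrite ler_wpM2l ?tdual_norm_ge0// [leRHS]/Num.norm/= le_max lexx orbT.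
have -> : tdual_sum mu =
    cst (tdual_sum mu 0) + (fun q : tdual F => tdual_sum 0 q).
  by apply/funext => p; rewrite tdual_sum_lr.
by have := is_diffD (is_diff_cst (tdual_sum mu 0) nu) dL; rewrite add0r.
Qed.

(** The differential splits linearly over the two summands of the dual; on each, the chain rule
    identifies it with the differential of a partial function. *)
Lemma functional_derivative_tdual_sum (f : tdual (E * F)%type -> R^o) mu nu :
  reflexive_space E -> reflexive_space F ->
  differentiable f (tdual_sum mu nu) ->
  functional_derivative f (tdual_sum mu nu) =
    (partial_fst f mu nu, partial_snd f mu nu).
Proof.
move=> rE rF df; apply: functional_derivative_eq => [[x y]|p].
  move=> pxy; congr pair; apply: tdual_separates => // p.
    by have := pxy (tdual_sum p 0); rewrite !tdual_sum_l.
  by have := pxy (tdual_sum 0 p); rewrite !tdual_sum_r.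
have [q [r ->]] := tdual_sum_decomp p.
have dl := is_diff_tdual_sum_l mu nu.
have dr := is_diff_tdual_sum_r mu nu.
rewrite [tdual_sum q r]tdual_sum_lr linearD tdual_addE tdual_sum_l tdual_sum_r.
congr (_ + _).
  rewrite [RHS]/= -functional_derivativeP//; last exact: differentiable_comp.
  rewrite -[RHS]/('d (f \o tdual_sum^~ nu) mu q).
  by rewrite [in RHS]diff_comp//= diff_val.
rewrite [RHS]/= -functional_derivativeP//; last exact: differentiable_comp.
by rewrite -[RHS]/('d (f \o tdual_sum mu) nu r) [in RHS]diff_comp//= diff_val.
Qed.

End FunctionalDerivative.

(** * Partial derivatives as values of the full differential *)

Section PartialDerivation.
Context {R : realType}.
Implicit Types V W X : normedModType R.

Lemma derive_fst V W X (f : V * W -> X) x y v :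
  differentiable f (x, y) -> 'D_v (fun x => f (x, y)) x = 'd f (x, y) (v, 0).
Proof.
move=> df; have dp := is_diff_pair (is_diff_id x) (is_diff_cst y x).
by have [_ ->] := is_derive_comp_diff v dp df.
Qed.

Lemma derive_snd V W X (f : V * W -> X) x y w :
  differentiable f (x, y) -> 'D_w (fun y => f (x, y)) y = 'd f (x, y) (0, w).
Proof.
move=> df; have dp := is_diff_pair (is_diff_cst x y) (is_diff_id y).
by have [_ ->] := is_derive_comp_diff w dp df.
Qed.

(** The tangent map is linear along the fibre, hence its own derivative there. *)
Lemma diff_tangent_map_vertical V W (f : V -> W) x v w :
  C2_near f x -> 'd (tangent_map f) (x, v) (0, w) = 'd f x w.
Proof.
move=> f2; have df : differentiable f x.
  exact: (nbhs_singleton (C2_near_diff f2)).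
rewrite -derive_snd; last exact: C2_near_diff_tangent.
have cd : continuous ('d f x) by exact: diff_continuous.
rewrite (_ : (fun _ => _) = 'd f x :> (V -> W))//.
by rewrite deriveE ?diff_lin//; exact: linear_differentiable.
Qed.

End PartialDerivation.

(** * Group operations and actions in charts *)

Section ChartCoordinates.
Context {R : realType}.

Lemma is_chart_nbhs_dom (M : topologicalType) (E : normedModType R)
    (c : chart M E) x : is_chart c -> chart_dom c x -> nbhs x (chart_dom c).
Proof. by move=> [[od _] _ _ _ _] cx; exact: open_nbhs_nbhs. Qed.

Lemma is_chart_nbhs_img (M : topologicalType) (E : normedModType R)
    (c : chart M E) x : is_chart c -> chart_dom c x -> nbhs (c x) (chart_img c).
Proof.
by move=> [[_ oi] cs _ _ _] cx; apply: open_nbhs_nbhs; split=> //; exact: cs.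
Qed.

Lemma is_chart_inv (M : topologicalType) (E : normedModType R)
    (c : chart M E) x : is_chart c -> chart_dom c x -> chart_inv c (c x) = x.
Proof. by move=> [_ _ _ [cK _] _] cx; apply: cK; rewrite inE. Qed.

Lemma is_chart_fun_inv (M : topologicalType) (E : normedModType R)
    (c : chart M E) y : is_chart c -> chart_img c y -> c (chart_inv c y) = y.
Proof. by move=> [_ _ _ [_ cK] _] cy; apply: cK; rewrite inE. Qed.

Lemma is_chart_inv_continuous (M : topologicalType) (E : normedModType R)
    (c : chart M E) y :
  is_chart c -> chart_img c y -> {for y, continuous (chart_inv c)}.
Proof. by move=> [_ _ _ _ [_ ci]] cy; apply: ci; rewrite inE. Qed.

(** Smoothness holds on the set where the coordinate expression is meaningful; continuity of [f] and
    of the inverse charts makes this set a neighbourhood of the point. *)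
Lemma smooth_map_prod_C2_near (M N P : topologicalType)
    (E F E' : normedModType R) (A : set (chart M E)) (B : set (chart N F))
    (C : set (chart P E')) (f : M * N -> P) c d e x y :
  is_chart c -> is_chart d -> is_chart e -> A c -> B d -> C e ->
  smooth_map (prod_atlas A B) C f ->
  chart_dom c x -> chart_dom d y -> chart_dom e (f (x, y)) ->
  C2_near (fun z => e (f (chart_inv c z.1, chart_inv d z.2))) (c x, d y).
Proof.
move=> hc hd he Ac Bd Ce [cf sf] cx dy efxy.
have cimg := is_chart_nbhs_img hc cx; have dimg := is_chart_nbhs_img hd dy.
exists (chart_img (prod_chart c d) `&`
    (f \o chart_inv (prod_chart c d)) @^-1` chart_dom e); last first.
  by apply: sf => //; exists c => //; exists d.
apply: filterI; first by exists (chart_img c, chart_img d).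
have ci : {for (c x, d y), continuous (f \o chart_inv (prod_chart c d))}.
  apply: continuous_comp; last exact: cf.
  apply: continuous_for_pair.
    apply: continuous_comp; first exact: cvg_fst.
    by apply: is_chart_inv_continuous => //; exact: nbhs_singleton cimg.
  apply: continuous_comp; first exact: cvg_snd.
  by apply: is_chart_inv_continuous => //; exact: nbhs_singleton dimg.
apply: (ci (chart_dom e)) => /=.
by rewrite !is_chart_inv//; exact: is_chart_nbhs_dom.
Qed.

End ChartCoordinates.

(** * The product of a Lie group in its chart at the identity *)

Section LieGroupCoordinates.
Context {R : realType} {E : normedModType R} (K : lieGroupType E).
Local Notation c := (lie_chart K).
Local Notation x1 := (c 1%g).

Lemma lie_chart_is_chart : is_chart c.
Proof.
by case: (@lie_atlasP R E K) => + _ _; apply; exact: lie_chart_atlas.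
Qed.

Definition chart_mul (z : E * E) : E :=
  c (chart_inv c z.1 * chart_inv c z.2)%g.

Lemma lie_chart_inv1 : chart_inv c x1 = 1%g.
Proof. exact: (is_chart_inv lie_chart_is_chart (@lie_chart1 _ _ _)). Qed.

Lemma near_lie_chart_img : \forall x \near x1, chart_img c x.
Proof. exact: (is_chart_nbhs_img lie_chart_is_chart (@lie_chart1 _ _ _)). Qed.

Lemma chart_mul_C2_near : C2_near chart_mul (x1, x1).
Proof.
apply: (smooth_map_prod_C2_near lie_chart_is_chart lie_chart_is_chart
  lie_chart_is_chart (@lie_chart_atlas _ _ _) (@lie_chart_atlas _ _ _)
  (@lie_chart_atlas _ _ _) (@lie_mul_smooth _ _ _));
  rewrite /= ?mulg1; exact: lie_chart1.
Qed.

Lemma chart_mulr1 x : chart_img c x -> chart_mul (x, x1) = x.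
Proof.
move=> cx; rewrite /chart_mul/= lie_chart_inv1 mulg1.
exact: (is_chart_fun_inv lie_chart_is_chart).
Qed.

Lemma chart_mul1r x : chart_img c x -> chart_mul (x1, x) = x.
Proof.
move=> cx; rewrite /chart_mul/= lie_chart_inv1 mul1g.
exact: (is_chart_fun_inv lie_chart_is_chart).
Qed.

Lemma near_diff_chart_mul :
  \forall x \near x1, differentiable chart_mul (x, x1).
Proof.
have h : {for x1, continuous (fun x : E => (x, x1))}.
  by apply: continuous_for_pair => //; exact: cst_continuous.
exact: (h _ (C2_near_diff chart_mul_C2_near)).
Qed.

(** Exhibits the field as a tangent map composed with an affine map, ready for one more application
    of the chain rule. *)
Lemma left_invariant_fieldE v : \forall x \near x1,
  left_invariant_field c v x = tangent_map chart_mul ((x, x1), (0, v)).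
Proof.
apply: filterS near_diff_chart_mul => x dm.
by rewrite /tangent_map/= -derive_snd.
Qed.

(** Right multiplication by the identity is the identity map around every [x] near [x1]. The whole
    neighbourhood matters, since the formula is used inside a field that is differentiated
    afterwards. *)
Lemma diff_chart_mul_l : \forall x \near x1,
  forall v, 'd chart_mul (x, x1) (v, 0) = v.
Proof.
have oi : open (chart_img c) by case: lie_chart_is_chart => -[].
near=> x => v; rewrite -derive_fst; last by near: x; exact: near_diff_chart_mul.
rewrite -[RHS](derive_id x); apply: near_eq_derive.
have xc : nbhs x (chart_img c).
  apply: open_nbhs_nbhs; split => //; near: x; exact: near_lie_chart_img.
by apply: filterS xc => y /chart_mulr1.
Unshelve. all: by end_near. Qed.

Lemma diff_chart_mul_r v : 'd chart_mul (x1, x1) (0, v) = v.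
Proof.
rewrite -derive_snd; last exact: nbhs_singleton near_diff_chart_mul.
rewrite -[RHS](derive_id x1); apply: near_eq_derive.
by apply: filterS near_lie_chart_img => y /chart_mul1r.
Qed.

Lemma left_invariant_field1 v : left_invariant_field c v x1 = v.
Proof.
rewrite (nbhs_singleton (left_invariant_fieldE v)).
exact: diff_chart_mul_r.
Qed.

(** A mixed second derivative of the product: along [v] in the right factor, then along [u] in the
    left one. *)
Lemma derive_left_invariant_field u v :
  'D_u (left_invariant_field c v) x1 =
  'd (tangent_map chart_mul) ((x1, x1), (0, v)) ((u, 0), 0).
Proof.
rewrite (near_eq_derive _ (left_invariant_fieldE v)).
have dx := is_diff_pair (is_diff_pair (is_diff_id x1) (is_diff_cst x1 x1))
  (is_diff_cst ((0, v) : E * E) x1).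
by have [_ ->] := is_derive_comp_diff u dx
  (C2_near_diff_tangent _ chart_mul_C2_near).
Qed.

End LieGroupCoordinates.

(** * The two actions and the matched pair group in the charts at the identities *)

Section MatchedPairCoordinates.
Context {R : realType} {E F : normedModType R}.
Context {G : lieGroupType E} {H : lieGroupType F} (A : matched_pair G H).
Local Notation phi := (lie_chart G).
Local Notation psi := (lie_chart H).
Local Notation a0 := (phi 1%g).
Local Notation b0 := (psi 1%g).

Definition chart_lact (z : F * E) : E :=
  phi (lact A (chart_inv psi z.1) (chart_inv phi z.2)).

Definition chart_ract (z : F * E) : F :=
  psi (ract A (chart_inv psi z.1) (chart_inv phi z.2)).

Lemma chart_lact_C2_near : C2_near chart_lact (b0, a0).
Proof.
apply: (smooth_map_prod_C2_near (lie_chart_is_chart H) (lie_chart_is_chart G)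
  (lie_chart_is_chart G) (@lie_chart_atlas _ _ _) (@lie_chart_atlas _ _ _)
  (@lie_chart_atlas _ _ _) (lact_smooth A));
  rewrite /= ?lactg1; exact: lie_chart1.
Qed.

Lemma chart_ract_C2_near : C2_near chart_ract (b0, a0).
Proof.
apply: (smooth_map_prod_C2_near (lie_chart_is_chart H) (lie_chart_is_chart G)
  (lie_chart_is_chart H) (@lie_chart_atlas _ _ _) (@lie_chart_atlas _ _ _)
  (@lie_chart_atlas _ _ _) (ract_smooth A));
  rewrite /= ?ractg1; exact: lie_chart1.
Qed.

Lemma near_diff_chart_lact :
  \forall b \near b0, differentiable chart_lact (b, a0).
Proof.
have h : {for b0, continuous (fun b : F => (b, a0))}.
  by apply: continuous_for_pair => //; exact: cst_continuous.
exact: (h _ (C2_near_diff chart_lact_C2_near)).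
Qed.

Lemma near_diff_chart_ract :
  \forall b \near b0, differentiable chart_ract (b, a0).
Proof.
have h : {for b0, continuous (fun b : F => (b, a0))}.
  by apply: continuous_for_pair => //; exact: cst_continuous.
exact: (h _ (C2_near_diff chart_ract_C2_near)).
Qed.

Lemma chart_lact1 b : chart_lact (b, a0) = a0.
Proof. by rewrite /chart_lact/= lie_chart_inv1 lactg1. Qed.

Lemma chart_ract1 b : chart_img psi b -> chart_ract (b, a0) = b.
Proof.
move=> psib; rewrite /chart_ract/= lie_chart_inv1 ractg1.
exact: (is_chart_fun_inv (lie_chart_is_chart H)).
Qed.

Lemma diff_chart_lact v : 'd chart_lact (b0, a0) (0, v) = v.
Proof.
rewrite -derive_snd; last exact: nbhs_singleton near_diff_chart_lact.
rewrite -[RHS](derive_id a0); apply: near_eq_derive.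
apply: filterS (near_lie_chart_img G) => a phia.
rewrite /chart_lact/= lie_chart_inv1 lact1g.
exact: (is_chart_fun_inv (lie_chart_is_chart G)).
Qed.

Lemma diff_chart_ract v : 'd chart_ract (b0, a0) (0, v) = 0.
Proof.
rewrite -derive_snd; last exact: nbhs_singleton near_diff_chart_ract.
rewrite (_ : (fun _ => _) = cst b0) ?derive_cst//.
by apply/funext => a; rewrite /chart_ract/= lie_chart_inv1 ract1g.
Qed.

(** The definition differentiates first in G and then in H, the order that the bracket of
    left-invariant fields also produces. *)
Lemma lact_algE eta xi :
  lact_alg A eta xi =
  'd (tangent_map chart_lact) ((b0, a0), (0, xi)) ((eta, 0), 0).
Proof.
have near_lact : \forall b \near b0,
    lact_tangent A (chart_inv psi b) xi =
    tangent_map chart_lact ((b, a0), (0, xi)).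
  apply: filterS near_diff_chart_lact => b dl.
  by rewrite /tangent_map/= -derive_snd.
rewrite /lact_alg (near_eq_derive _ near_lact).
have db := is_diff_pair (is_diff_pair (is_diff_id b0) (is_diff_cst a0 b0))
  (is_diff_cst ((0, xi) : F * E) b0).
by have [_ ->] := is_derive_comp_diff eta db
  (C2_near_diff_tangent _ chart_lact_C2_near).
Qed.

Lemma ract_algE eta xi :
  ract_alg A eta xi =
  'd (tangent_map chart_ract) ((b0, a0), (eta, 0)) ((0, xi), 0).
Proof.
have h : {for a0, continuous (fun a : E => (b0, a))}.
  by apply: continuous_for_pair => //; exact: cst_continuous.
have near_ract : \forall a \near a0,
    ract_tangent A eta (chart_inv phi a) =
    tangent_map chart_ract ((b0, a), (eta, 0)).
  have : \forall a \near a0, differentiable chart_ract (b0, a).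
    exact: (h _ (C2_near_diff chart_ract_C2_near)).
  apply: filterS => a dr.
  by rewrite /tangent_map/= -derive_fst.
rewrite /ract_alg (near_eq_derive _ near_ract).
have da := is_diff_pair (is_diff_pair (is_diff_cst b0 a0) (is_diff_id a0))
  (is_diff_cst ((eta, 0) : F * E) a0).
by have [_ ->] := is_derive_comp_diff xi da
  (C2_near_diff_tangent _ chart_ract_C2_near).
Qed.

(** The coordinate formula is valid while the results of both actions stay in the chart domains. At
    the identity of G they are the identity and the point with coordinate [b], so continuity gives a
    neighbourhood. *)
Lemma near_matched_product a b : chart_img psi b ->
  \forall w \near (a0, b0),
    matched_chart A (chart_inv (matched_chart A) (a, b) *
                     chart_inv (matched_chart A) w)%g =
    (chart_mul G (a, chart_lact (b, w.1)),
     chart_mul H (chart_ract (b, w.1), w.2)).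
Proof.
move=> psib.
have cphi : {for a0, continuous (chart_inv phi)}.
  exact: (is_chart_inv_continuous (lie_chart_is_chart G)
    (nbhs_singleton (near_lie_chart_img G))).
have cpair : {for a0, continuous (fun x => (chart_inv psi b, chart_inv phi x))}.
  by apply: continuous_for_pair => //; exact: cst_continuous.
have lact_dom : \forall x \near a0,
    chart_dom phi (lact A (chart_inv psi b) (chart_inv phi x)).
  have cl : {for a0, continuous (fun x =>
      lact A (chart_inv psi b) (chart_inv phi x))}.
    exact: (continuous_comp cpair ((lact_smooth A).1 _)).
  apply: (cl (chart_dom phi)); rewrite lie_chart_inv1 lactg1.
  exact: (is_chart_nbhs_dom (lie_chart_is_chart G) (@lie_chart1 _ _ _)).
have ract_dom : \forall x \near a0,
    chart_dom psi (ract A (chart_inv psi b) (chart_inv phi x)).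
  have cr : {for a0, continuous (fun x =>
      ract A (chart_inv psi b) (chart_inv phi x))}.
    exact: (continuous_comp cpair ((ract_smooth A).1 _)).
  apply: (cr (chart_dom psi)); rewrite lie_chart_inv1 ractg1.
  apply: (is_chart_nbhs_dom (lie_chart_is_chart H)).
  by case: (lie_chart_is_chart H) => _ _ + _ _; apply.
have near1 P : nbhs a0 P -> \forall w \near (a0, b0), P w.1 by exact: cvg_fst.
near=> w; rewrite /chart_mul/=.
rewrite (is_chart_inv (lie_chart_is_chart G)); last first.
  by near: w; exact: near1 lact_dom.
rewrite (is_chart_inv (lie_chart_is_chart H))//.
by near: w; exact: near1 ract_dom.
Unshelve. all: by end_near. Qed.

Lemma left_invariant_field_matchedE xi eta :
  \forall z \near (a0, b0),
    left_invariant_field (matched_chart A) (xi, eta) z =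
    (tangent_map (chart_mul G)
       ((z.1, a0), (0, tangent_map chart_lact ((z.2, a0), (0, xi)))),
     tangent_map chart_ract ((z.2, a0), (0, xi)) +
     tangent_map (chart_mul H) ((z.2, b0), (0, eta))).
Proof.
have near1 P : nbhs a0 P -> \forall z \near (a0, b0), P z.1 by exact: cvg_fst.
have near2 P : nbhs b0 P -> \forall z \near (a0, b0), P z.2 by exact: cvg_snd.
near=> z; have -> : z = (z.1, z.2) by case: (z).
have psib : chart_img psi z.2 by near: z; exact: near2 (near_lie_chart_img H).
have dm : differentiable (chart_mul G) (z.1, a0).
  by near: z; exact: near1 (near_diff_chart_mul G).
have dn : differentiable (chart_mul H) (z.2, b0).
  by near: z; exact: near2 (near_diff_chart_mul H).
have dnl v : 'd (chart_mul H) (z.2, b0) (v, 0) = v.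
  by move: v; near: z; exact: near2 (diff_chart_mul_l H).
have dl : differentiable chart_lact (z.2, a0).
  by near: z; exact: near2 near_diff_chart_lact.
have dr : differentiable chart_ract (z.2, a0).
  by near: z; exact: near2 near_diff_chart_ract.
rewrite /left_invariant_field.
rewrite -[matched_chart A 1%g]/(a0, b0).
rewrite (near_eq_derive _ (near_matched_product z.1 psib)).
have da : is_diff (a0, b0) (fun w => (z.2, w.1)) (fun w => (0, w.1)).
  exact: (is_diff_pair (is_diff_cst z.2 (a0, b0)) (is_diff_fst (a0, b0))).
have dlw := is_diff_comp da (differentiableP dl).
have drw := is_diff_comp da (differentiableP dr).
have dmw := is_diff_pair (is_diff_cst z.1 (a0, b0)) dlw.
have dnw := is_diff_pair drw (is_diff_snd (a0, b0)).
(* At the base point the actions return [a0] and [z.2], where the products are already known to be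
   differentiable. *)
have dm' : differentiable (chart_mul G) (z.1, chart_lact (z.2, a0)).
  by rewrite chart_lact1.
have dn' : differentiable (chart_mul H) (chart_ract (z.2, a0), b0).
  by rewrite chart_ract1.
have [_ ->] := is_derive_pair (is_derive_comp_diff (xi, eta) dmw dm')
  (is_derive_comp_diff (xi, eta) dnw dn').
rewrite /= chart_lact1 chart_ract1// /tangent_map/=; congr pair.
(* The term from the right action is seen as the image of itself under the derivative of the product
   in its left factor; linearity then merges the two terms. *)
rewrite -[X in X + _]dnl -linearD; congr ('d _ _ _).
by congr pair; rewrite /= ?addr0 ?add0r.
Unshelve. all: by end_near. Qed.

(** The first component varies through its base point, which gives the field of G, and through the
    vector transported there, which gives the left action. *)
Lemma derive_left_invariant_field_matched u v xi eta :
  'D_(u, v) (left_invariant_field (matched_chart A) (xi, eta)) (a0, b0) =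
  ('D_u (left_invariant_field phi xi) a0 + lact_alg A v xi,
   'd (tangent_map chart_ract) ((b0, a0), (0, xi)) ((v, 0), 0)
   + 'D_v (left_invariant_field psi eta) b0).
Proof.
rewrite (near_eq_derive _ (left_invariant_field_matchedE _ _)).
have db : is_diff (a0, b0) (fun z => ((z.2, a0), (0, xi)) : (F * E) * (F * E))
    (fun z => ((z.2, 0), 0)).
  exact: (is_diff_pair
    (is_diff_pair (is_diff_snd (a0, b0)) (is_diff_cst a0 (a0, b0)))
    (is_diff_cst ((0, xi) : F * E) (a0, b0))).
have db' : is_diff (a0, b0) (fun z => ((z.2, b0), (0, eta)) : (F * F) * (F * F))
    (fun z => ((z.2, 0), 0)).
  exact: (is_diff_pair
    (is_diff_pair (is_diff_snd (a0, b0)) (is_diff_cst b0 (a0, b0)))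
    (is_diff_cst ((0, eta) : F * F) (a0, b0))).
have dl := is_diff_comp db
  (differentiableP (C2_near_diff_tangent (0, xi) chart_lact_C2_near)).
have da := is_diff_pair
  (is_diff_pair (is_diff_fst (a0, b0)) (is_diff_cst a0 (a0, b0)))
  (is_diff_pair (is_diff_cst (0 : E) (a0, b0)) dl).
have dP := is_derive_comp_diff (u, v) da
  (C2_near_diff_tangent _ (chart_mul_C2_near G)).
have dr := is_derive_comp_diff (u, v) db
  (C2_near_diff_tangent (0, xi) chart_ract_C2_near).
have dn := is_derive_comp_diff (u, v) db'
  (C2_near_diff_tangent (0, eta) (chart_mul_C2_near H)).
have [_ ->] := is_derive_pair dP (is_deriveD dr dn).
rewrite /= !derive_left_invariant_field lact_algE.
rewrite /tangent_map/= diff_chart_lact.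
congr pair.
(* The action term is rewritten as a fibre derivative of the tangent map of the product, so that it
   joins the base-point term by linearity. *)
rewrite -[X in _ + X](diff_chart_mul_r G).
rewrite -(diff_tangent_map_vertical (0, xi)); last exact: chart_mul_C2_near.
rewrite -linearD; congr ('d _ _ _).
by congr (pair (pair _ _) (pair _ _)); rewrite /= ?addr0 ?add0r.
Qed.

Lemma left_invariant_field_matched1 xi eta :
  left_invariant_field (matched_chart A) (xi, eta) (a0, b0) = (xi, eta).
Proof.
rewrite (nbhs_singleton (left_invariant_field_matchedE xi eta)) /tangent_map/=.
by rewrite diff_chart_lact diff_chart_ract !diff_chart_mul_r add0r.
Qed.

(** The second derivatives of the right action keep the order in which the fields produce them,
    because their symmetry is established after pairing with a functional. *)
Lemma lie_bracket_matched xi1 eta1 xi2 eta2 :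
  lie_bracket (matched_chart A) (xi1, eta1) (xi2, eta2) =
  (lie_bracket phi xi1 xi2 + lact_alg A eta1 xi2 - lact_alg A eta2 xi1,
   lie_bracket psi eta1 eta2
   + 'd (tangent_map chart_ract) ((b0, a0), (0, xi2)) ((eta1, 0), 0)
   - 'd (tangent_map chart_ract) ((b0, a0), (0, xi1)) ((eta2, 0), 0)).
Proof.
rewrite /lie_bracket /field_bracket.
rewrite -[matched_chart A 1%g]/(a0, b0).
rewrite !left_invariant_field_matched1 !derive_left_invariant_field_matched.
rewrite !left_invariant_field1.
congr pair => /=; rewrite opprD.
  by rewrite addrACA !addrA.
by rewrite addrACA addrC addrA.
Qed.

(* [ract_alg] differentiates first in H and then in G, whereas the bracket of
   left-invariant fields produces the derivatives in the opposite order. *)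
Lemma tdual_ract_algE (nu : tdual F) eta xi :
  nu (ract_alg A eta xi) =
  nu ('d (tangent_map chart_ract) ((b0, a0), (0, xi)) ((eta, 0), 0)).
Proof. by rewrite ract_algE (C2_near_symmetric _ _ _ chart_ract_C2_near). Qed.

Lemma tdual_sum_lie_bracket (mu : tdual E) (nu : tdual F) xi1 eta1 xi2 eta2 :
  tdual_sum mu nu (lie_bracket (matched_chart A) (xi1, eta1) (xi2, eta2)) =
  mu (lie_bracket phi xi1 xi2) + nu (lie_bracket psi eta1 eta2)
  + mu (lact_alg A eta1 xi2) - mu (lact_alg A eta2 xi1)
  + nu (ract_alg A eta1 xi2) - nu (ract_alg A eta2 xi1).
Proof.
by rewrite lie_bracket_matched tdual_sum_addB -!tdual_ract_algE.
Qed.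

End MatchedPairCoordinates.

Theorem proposition3p3 (R : realType) (E F : normedModType R)
    (G : lieGroupType E) (H : lieGroupType F) (A : matched_pair G H)
    (reflE : reflexive_space E) (reflF : reflexive_space F)
    (f1 f2 : tdual (E * F)%type -> R^o) (mu : tdual E) (nu : tdual F)
    (df1 : differentiable f1 (tdual_sum mu nu))
    (df2 : differentiable f2 (tdual_sum mu nu)) :
  let f1mu := partial_fst f1 mu nu in
  let f1nu := partial_snd f1 mu nu in
  let f2mu := partial_fst f2 mu nu in
  let f2nu := partial_snd f2 mu nu in
  lie_poisson (matched_chart A) f1 f2 (tdual_sum mu nu) =
    mu (lie_bracket (lie_chart G) f1mu f2mu)
    + nu (lie_bracket (lie_chart H) f1nu f2nu)
    + mu (lact_alg A f1nu f2mu) - mu (lact_alg A f2nu f1mu)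
    + nu (ract_alg A f1nu f2mu) - nu (ract_alg A f2nu f1mu).
Proof.
move=> f1mu f1nu f2mu f2nu.
rewrite /lie_poisson !functional_derivative_tdual_sum//.
exact: tdual_sum_lie_bracket.
Qed.
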